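(* For all integers $k\geq 3$ and $p\geq 5$, we have $g^k_1(p)< 2^{2k(p-2)-3}$.
   Context: A Gallai-$k$-coloring of the complete graph $K_n$ is a map $c:E(K_n)\to\{1,\dots,k\}$ (not necessarily surjective) with no rainbow triangle, i.e. every triangle receives at most two distinct colors. $g^k_1(p)$ denotes the smallest positive integer $n$ such that every Gallai-$k$-coloring of $K_n$ contains a monochromatic copy of $K_p$. *)

(* Defs.v *)
From mathcomp Require Import all_boot.

Set Implicit Arguments.
Unset Strict Implicit.
Unset Printing Implicit Defensive.

(* K_n has vertex set 'I_n, and the edge xy is the two-element set [set x; y].
   The colors {1, ..., k} are represented by 'I_k.  A coloring is a function on
   all vertex subsets; every definition below only looks at its values on
   two-element sets, so the other values are irrelevant. *)
Definition coloring (k n : nat) := {set 'I_n} -> 'I_k.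

Definition gallai (k n : nat) (c : coloring k n) : Prop :=
  forall x y z : 'I_n, uniq [:: x; y; z] ->
    #|[set c [set x; y]; c [set y; z]; c [set x; z]]| <= 2.

Definition has_mono_clique (k n p : nat) (c : coloring k n) : Prop :=
  exists (A : {set 'I_n}) (i : 'I_k), #|A| = p /\
    forall x y : 'I_n, x \in A -> y \in A -> x != y -> c [set x; y] = i.

Definition gallai_arrows (k p n : nat) : Prop :=
  forall c : coloring k n, gallai c -> has_mono_clique p c.

(* g = g^k_1(p).  A relation is used because the existence of such a number is
   a theorem; its uniqueness is immediate from minimality. *)
Definition is_gallai_number (k p g : nat) : Prop :=
  [/\ 0 < g, gallai_arrows k p g &
      forall n : nat, 0 < n -> gallai_arrows k p n -> g <= n].

(* Main.v *)
Require Import Defs.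
From mathcomp Require Import all_boot.
From mathcomp Require Import boolp zify.

Set Implicit Arguments.
Unset Strict Implicit.
Unset Printing Implicit Defensive.

(** A Gallai coloring of [n >= 2] vertices has a vertex with more than [n / 3]
    neighbors in a single color ([exists_large_color_neighborhood]).  This
    needs only a double counting, not the structure theorem for Gallai
    colorings: fix a vertex [v] and call a pair [x, y] of other vertices
    crossing when [vx] and [vy] have distinct colors.  As the triangle [vxy]
    is not rainbow, [xy] then has the color of [vx] or that of [vy].  If all
    monochromatic degrees are at most [d], each of the [n - 1] vertices [x]
    lies in at least [n - 1 - d] crossing pairs, while at most [d - 1] of
    these have the color of [vx], since [v] is one more neighbor of [x] in that
    color.  Hence [n - 1 - d <= 2 (d - 1)], that is, [n < 3 d].

    Passing to such a neighborhood in color [i] lowers by one the size of the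
    clique to be found in color [i].  So, as in the Erdos-Szekeres argument, but
    at the cost of a factor 3 per step whatever the number of colors, about
    [3 ^ s / 2] vertices force, for some [i], a clique of size [m i + 2] in
    color [i], where [s] is the sum of the [m i] ([mono_clique_of_card]).
    With [m i = p - 2] for all [i] this gives [s = k (p - 2)] and the bound
    [3 ^ s] on the Gallai number, which is less than [2 ^ (2 s - 3) = 4 ^ s / 8]
    because [s >= 9]. *)

Section GallaiColoring.

Variables (k n : nat) (c : coloring k n).

Definition color_nbhd (V : {set 'I_n}) (x : 'I_n) (i : 'I_k) : {set 'I_n} :=
  [set y in V | (y != x) && (c [set x; y] == i)].

Definition monochromatic (A : {set 'I_n}) (i : 'I_k) : Prop :=
  forall x y, x \in A -> y \in A -> x != y -> c [set x; y] = i.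

Lemma color_nbhdS V x i : color_nbhd V x i \subset V.
Proof. by apply/subsetP => y; rewrite inE => /andP[]. Qed.

Lemma gallai_color_third_edge v x y : gallai c ->
    x != v -> y != v -> c [set v; x] != c [set v; y] ->
  (c [set x; y] == c [set v; x]) || (c [set x; y] == c [set v; y]).
Proof.
move=> gal_c xv yv neq_c.
have xy : x != y by apply: contraNneq neq_c => ->.
have uniq_vxy : uniq [:: v; x; y].
  by rewrite /= !inE negb_or (eq_sym v x) (eq_sym v y) xv yv xy.
have := gal_c _ _ _ uniq_vxy; apply: contraTT => /norP[c1 c2].
rewrite -ltnNge setUC cardsU1 cards2 !inE negb_or.
by rewrite [c [set v; x] == c [set x; y]]eq_sym c1 (eq_sym (c [set v; y])) neq_c
           (eq_sym (c [set v; y])) c2.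
Qed.

(** Fix [v] in [V] and let [W] be the rest of [V].  The ordered crossing pairs
    in [W] number at least [#|W| * (#|W| - d)], since each color class of [v]
    has at most [d] elements.  Each crossing pair is owned by one of its ends,
    and each vertex owns at most [d - 1] pairs, so there are at most
    [2 * #|W| * (d - 1)] of them. *)
Lemma card_lt_3_max_color_degree (V : {set 'I_n}) d : gallai c -> 1 < #|V| ->
    (forall x i, x \in V -> #|color_nbhd V x i| <= d) ->
  #|V| < 3 * d.
Proof.
move=> gal_c V_gt1 deg_le.
have /card_gt0P[v vV] : 0 < #|V| by apply: ltnW.
pose W := V :\ v.
have cardV : #|V| = #|W|.+1 by rewrite (cardsD1 v) vV.
have WV x : x \in W -> (x != v) && (x \in V) by rewrite !inE.
pose cross x y := c [set v; x] != c [set v; y].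
pose owns x y := cross x y && (c [set x; y] == c [set v; x]).
have sum_bool (b : pred 'I_n) :
    \sum_(y in W) nat_of_bool (b y) = #|[set y in W | b y]|.
  by rewrite -sum1dep_card big_mkcondr; apply: eq_bigr => y _; case: (b y).
(* The vertices of [W] not crossing with [x] are neighbors of [v] in the color
   of [vx]. *)
have cross_ge x : x \in W -> #|W| <= d + \sum_(y in W) cross x y.
  move=> xW; rewrite sum_bool -(cardsID (color_nbhd V v (c [set v; x])) W).
  apply: leq_add.
    exact: leq_trans (subset_leq_card (subsetIr _ _)) (deg_le _ _ vV).
  apply/subset_leq_card/subsetP => y; rewrite in_setD !inE andbC.
  case/andP=> /andP[yv yV]; rewrite yv yV /=.
  by rewrite /cross eq_sym.
(* The pairs owned by [x] have the color of [vx]; the successor counts [v]. *)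
have owns_lt x : x \in W -> (\sum_(y in W) owns x y).+1 <= d.
  move=> /WV/andP[xv xV]; apply: leq_trans (deg_le x (c [set v; x]) xV).
  rewrite sum_bool (cardsD1 v (color_nbhd _ _ _)) inE vV eq_sym xv setUC eqxx.
  rewrite add1n ltnS; apply/subset_leq_card/subsetP => y.
  rewrite !inE => /andP[/andP[-> ->]] /andP[/= crossxy ->]; rewrite andbT.
  by apply: contraNneq crossxy => ->.
have cross_le x y : x \in W -> y \in W -> cross x y <= owns x y + owns y x.
  move=> /WV/andP[xv _] /WV/andP[yv _]; rewrite /owns (setUC [set y]).
  have -> : cross y x = cross x y by rewrite /cross eq_sym.
  case: (boolP (cross x y)) => //= /(gallai_color_third_edge gal_c xv yv).
  by case/orP => ->; rewrite ?addn1.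
have count_cross :
    \sum_(x in W) \sum_(y in W) cross x y
      <= 2 * \sum_(x in W) \sum_(y in W) owns x y.
  rewrite mul2n -addnn [X in _ <= _ + X]exchange_big -big_split; apply: leq_sum => x xW.
  by rewrite -big_split; apply: leq_sum => y yW; apply: cross_le.
have count_lower :
    #|W| * #|W| <= #|W| * d + \sum_(x in W) \sum_(y in W) cross x y.
  by rewrite -!sum_nat_const -big_split; apply: leq_sum => x; apply: cross_ge.
have count_owns :
    (\sum_(x in W) \sum_(y in W) owns x y) + #|W| <= #|W| * d.
  rewrite -[X in _ + X]muln1 -!sum_nat_const -big_split.
  by apply: leq_sum => x xW; rewrite /= addn1; apply: owns_lt.
have W_gt0 : 0 < #|W| by rewrite -ltnS -cardV.
(* The counts give [#|W| * (#|W| + 2) <= #|W| * (3 * d)]. *)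
suff : #|W| + 2 <= 3 * d by rewrite cardV; lia.
rewrite -(leq_pmul2l W_gt0); nia.
Qed.

Lemma exists_large_color_neighborhood (V : {set 'I_n}) :
    gallai c -> 1 < #|V| ->
  exists x i, x \in V /\ #|V| < 3 * #|color_nbhd V x i|.
Proof.
move=> gal_c V_gt1.
case: (boolP [exists x in V, exists i, #|V| < 3 * #|color_nbhd V x i|]).
  by case/exists_inP => x xV /existsP[i lt_V]; exists x, i.
rewrite negb_exists_in => /forall_inP no_large.
suff : #|V| < 3 * (#|V| %/ 3) by rewrite ltnNge mulnC leq_divM.
apply: card_lt_3_max_color_degree => // x i xV.
have := no_large x xV; rewrite negb_exists => /forallP/(_ i).
by rewrite -leqNgt leq_divRL // mulnC.
Qed.

Lemma monochromaticU1 V x i (A : {set 'I_n}) : A \subset color_nbhd V x i ->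
  monochromatic A i -> monochromatic (x |: A) i.
Proof.
move=> /subsetP AN monoA y z.
have xA w : w \in A -> c [set x; w] = i.
  by move/AN; rewrite inE => /and3P[_ _ /eqP].
rewrite !in_setU1 => /predU1P[->|yA] /predU1P[->|zA] yz.
- by rewrite eqxx in yz.
- exact: xA.
- by rewrite setUC xA.
- exact: monoA.
Qed.

(** Erdos-Szekeres induction on the sum of the [m i].  If [x] has a large
    neighborhood [N] in color [i] and [m i > 0], lower [m i] by one inside [N]:
    a clique found there in color [i] is completed by [x].  If [m i = 0], the
    edge from [x] to any element of [N] is the clique.  The additive constant
    is chosen so that the bound passes from [V] to [N] when [#|V| < 3 * #|N|],
    and for a zero sum it says exactly that [V] contains an edge. *)
Lemma mono_clique_of_card (m : 'I_k -> nat) (V : {set 'I_n}) : gallai c ->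
    3 ^ (\sum_i m i) + 1 < 2 * #|V| ->
  exists (A : {set 'I_n}) i, [/\ A \subset V, #|A| = (m i).+2 & monochromatic A i].
Proof.
move=> gal_c; have [s] := ubnP (\sum_i m i).
elim: s => // s IHs in m V *; rewrite ltnS => le_s V_large.
have V_gt1 : 1 < #|V| by have := expn_gt0 3 (\sum_i m i); lia.
have [x [i [xV lt_V]]] := exists_large_color_neighborhood gal_c V_gt1.
set N := color_nbhd V x i in lt_V.
have xN : x \notin N by rewrite inE eqxx andbF.
case def_mi: (m i) => [|mi].
  have /card_gt0P[y yN] : 0 < #|N| by lia.
  exists (x |: [set y]), i; split.
  - by rewrite subUset !sub1set xV (subsetP (color_nbhdS V x i)).
  - rewrite cardsU1 cards1 def_mi inE.
    by case: eqP xN yN => // -> /negP.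
  - apply: (@monochromaticU1 V); first by rewrite sub1set.
    by move=> a b /set1P-> /set1P->; rewrite eqxx.
pose m' j := if j == i then mi else m j.
have sum_m : \sum_j m j = (\sum_j m' j).+1.
  rewrite (bigD1 i) //= [in RHS](bigD1 i) //= /m' eqxx def_mi addSn.
  by congr (_ + _).+1; apply: eq_bigr => j /negbTE->.
have [||A [j [AN cardA monoA]]] := IHs m' N.
- by rewrite -ltnS -sum_m.
- by move: V_large; rewrite sum_m expnS; lia.
have AV := subset_trans AN (color_nbhdS V x i).
case: (eqVneq j i) => [def_j | neq_ji]; last first.
  by exists A, j; split; rewrite // cardA /m' (negbTE neq_ji).
subst j; exists (x |: A), i; split; last exact: monochromaticU1 AN monoA.
  by rewrite subUset sub1set xV.
by rewrite cardsU1 cardA (contra (subsetP AN x) xN) /m' eqxx def_mi.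
Qed.

End GallaiColoring.

Lemma gallai_arrows_exp3 k p : 0 < k * (p - 2) -> 
  gallai_arrows k p (3 ^ (k * (p - 2))).
Proof.
move=> s_gt0 c gal_c.
have := @mono_clique_of_card _ _ c (fun=> p - 2) setT gal_c.
rewrite sum_nat_const !card_ord cardsT card_ord.
case=> [|A [i [_ cardA monoA]]]; last by exists A, i; split=> //; lia.
have : 3 ^ 1 <= 3 ^ (k * (p - 2)) by rewrite leq_exp2l.
lia.
Qed.

Lemma ltn_exp3_exp2 s : 9 <= s -> 3 ^ s < 2 ^ (2 * s - 3).
Proof.
move=> s_ge9; rewrite -(subnK s_ge9); move: (s - 9) => t.
have -> : 2 * (t + 9) - 3 = 2 * t + 15 by lia.
rewrite (expnD 3) (expnD 2 _ 15) (expnM 2 2); apply: (@leq_ltn_trans (4 ^ t * 3 ^ 9)).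
  by apply: leq_mul => //; case: t => // t; rewrite leq_exp2r.
by rewrite ltn_pmul2l // expn_gt0.
Qed.

Theorem proposition1p7 (k p : nat) (hk : 3 <= k) (hp : 5 <= p) :
  exists g : nat,
    is_gallai_number k p g /\ g < 2 ^ (2 * k * (p - 2) - 3).
Proof.
have s_ge9 : 9 <= k * (p - 2) by rewrite (@leq_mul 3 3) //; lia.
pose P n := (0 < n) && `[< gallai_arrows k p n >].
have P_exp3 : P (3 ^ (k * (p - 2))).
  rewrite /P expn_gt0; apply/asboolP; apply: gallai_arrows_exp3.
  exact: leq_trans s_ge9.
case: (ex_minnP (ex_intro (fun n => P n) _ P_exp3)) => g /andP[g_gt0 /asboolP arr_g] g_min.
exists g; split.
  by split=> // n n_gt0 arr_n; apply: g_min; rewrite /P n_gt0; apply/asboolP.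
rewrite -mulnA; apply: leq_ltn_trans (ltn_exp3_exp2 s_ge9); exact: g_min.
Qed.
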